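(* For all (positive) partitions $\lambda,\mu$ and every $m\ge1$, the skew spin $q$-Whittaker polynomials satisfy the stability relation $$ \mathbb{F}_{\lambda/\mu}(x_1,\dots,x_{m-1},-s)=\mathbb{F}_{\lambda/\mu}(x_1,\dots,x_{m-1}). $$
   Context: Fix $q,s\in\mathbb{C}$ with $|q|<1$, $|s|<1$. Write $(a;q)_m=\prod_{i=1}^m(1-aq^{i-1})$ for $m\ge 1$, $(a;q)_0=1$, $(a;q)_\infty=\prod_{i\ge1}(1-aq^{i-1})$. A (positive) partition is a finite, possibly empty, sequence $\lambda_1\ge\dots\ge\lambda_\ell\ge1$ of integers, with $\lambda_i:=0$ for $i>\ell$. Vertex weights: for $x\in\mathbb{C}$ and $i,j,k,\ell\in\mathbb{Z}_{\ge0}$, $$W_x(i,j;k,\ell)=\mathbf 1_{i+j=k+\ell}\,\mathbf 1_{i\ge\ell}\;x^\ell\frac{(-s/x;q)_\ell\,(-sx;q)_{i-\ell}\,(q;q)_k}{(q;q)_\ell\,(q;q)_{i-\ell}\,(s^2;q)_k},$$ where $x^\ell(-s/x;q)_\ell$ is read as the polynomial $\prod_{r=0}^{\ell-1}(x+sq^r)$. ($i,j,k,\ell$ are the numbers of paths on the bottom, left, top, right edges of the vertex.) Skew spin $q$-Whittaker polynomial: for partitions $\lambda,\mu$, $$\mathbb{F}_{\lambda/\mu}(x_1,\dots,x_n)=\sum\prod_{r=1}^n\left[x_r^{h_{r,0}}\frac{(-s/x_r;q)_{h_{r,0}}}{(q;q)_{h_{r,0}}}\prod_{c\ge1}W_{x_r}\big(v_{r-1,c},h_{r,c-1};v_{r,c},h_{r,c}\big)\right],$$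 the sum running over all non-negative integers $h_{r,c}$ ($1\le r\le n$, $c\ge0$), with $h_{r,c}=0$ for all large $c$, and $v_{r,c}$ ($0\le r\le n$, $c\ge1$) subject to $v_{0,c}=\mu_c-\mu_{c+1}$ and $v_{n,c}=\lambda_c-\lambda_{c+1}$; all but finitely many vertex weights equal $W_x(0,0;0,0)=1$ in any nonzero term. For $n=0$ (no rows) this reads $\mathbb{F}_{\lambda/\mu}()=\mathbf 1_{\lambda=\mu}$. (Equivalently: the partition function on columns $0,1,2,\dots$ and rows $1,\dots,n$ numbered from bottom to top, row $r$ carrying $x_r$, all left and right boundary edges empty, infinitely many paths in column $0$ with weights $W_x(\infty,0;\infty,\ell)=x^\ell\frac{(-s/x;q)_\ell(-sx;q)_\infty}{(q;q)_\ell(s^2;q)_\infty}$, divided by $\prod_{i=1}^n(-sx_i;q)_\infty/(s^2;q)_\infty$.) *)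

(* Defs.v *)
From HB Require Import structures.
From mathcomp Require Import all_boot all_order all_algebra.
From mathcomp Require Import all_classical all_reals all_analysis.
From mathcomp Require Import complex.

Set Implicit Arguments.
Unset Strict Implicit.
Unset Printing Implicit Defensive.

Import Order.TTheory GRing.Theory Num.Theory.
Import numFieldNormedType.Exports.

Local Open Scope classical_set_scope.
Local Open Scope ring_scope.

Definition is_partition (la : seq nat) : bool := sorted geq la && (0%N \notin la).

(* 0-based: [part_diff la c] is la_(c+1) - la_(c+2), a true difference when [la]
   is weakly decreasing. *)
Definition part_diff (la : seq nat) (c : nat) : nat :=
  (nth 0 la c - nth 0 la c.+1)%N.

Section SpinQWhittaker.
Variables (C : numFieldType) (q s : C).

Definition qpoch (a : C) (m : nat) : C := \prod_(i < m) (1 - a * q ^+ i).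

(* The polynomial x^l (-s/x; q)_l, which also makes sense at x = 0. *)
Definition xpoch (x : C) (l : nat) : C := \prod_(r < l) (x + s * q ^+ r).

Definition vweight (x : C) (i j k l : nat) : C :=
  if (i + j == k + l)%N && (l <= i)%N then
    xpoch x l * qpoch (- s * x) (i - l) * qpoch q k /
      (qpoch q l * qpoch q (i - l) * qpoch (s ^+ 2) k)
  else 0.

(* Path configurations with [n] rows: [(h, v)] where
   - [h r c] is h_(r+1, c), for r : 'I_n and c >= 0;
   - [v r c] is v_(r, c+1), for r : 'I_n.+1 and c >= 0. *)
Definition config (n : nat) : Type :=
  (('I_n -> nat -> nat) * ('I_n.+1 -> nat -> nat))%type.

Definition admissible (la mu : seq nat) (n : nat) (hv : config n) : Prop :=
  [/\ forall r, \forall c \near \oo, hv.1 r c = 0%N,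
      forall c, hv.2 ord0 c = part_diff mu c
    & forall c, hv.2 ord_max c = part_diff la c].

(* Column c.+1 carries the edges v _ c (vertical), h _ c (left), h _ c.+1
   (right). The infinite product over columns is the limit of its partial
   products. *)
Definition row_weight (n : nat) (hv : config n) (x : C) (r : 'I_n) : C :=
  xpoch x (hv.1 r 0%N) / qpoch q (hv.1 r 0%N) *
  limn (fun N : nat => \prod_(0 <= c < N)
    vweight x (hv.2 (widen_ord (leqnSn n) r) c) (hv.1 r c)
              (hv.2 (lift ord0 r) c) (hv.1 r c.+1)).

(* Only finitely many admissible configurations have nonzero weight, so this
   [fsbigop] sum (by convention 0 on infinite supports) is the intended one. *)
Definition skew_spin_qW (la mu : seq nat) (n : nat) (x : n.-tuple C) : C :=
  \sum_(hv \in [set hv : config n | admissible la mu hv])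
    \prod_(r < n) row_weight hv (tnth x r) r.

End SpinQWhittaker.

(* Main.v *)
Require Import Defs.
From HB Require Import structures.
From mathcomp Require Import all_boot all_order all_algebra.
From mathcomp Require Import all_classical all_reals all_analysis.
From mathcomp Require Import complex.

Set Implicit Arguments.
Unset Strict Implicit.
Unset Printing Implicit Defensive.

Import Order.TTheory GRing.Theory Num.Theory.
Local Open Scope ring_scope.

(** At [x = -s] the factor [x^l (-s/x; q)_l] vanishes unless [l = 0], and
    [W_{-s}(i, 0; k, 0)] is the indicator of [i = k]. A row carrying [-s] thus
    has weight [1] if it has no horizontal paths and its vertical paths go
    straight up, and weight [0] otherwise. Deleting the last row is therefore a
    weight-preserving bijection between the contributing configurations. *)

Section LastRow.
Import numFieldNormedType.Exports.
Variables (C : numFieldType) (q s : C).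
Hypotheses (hq : `|q| < 1) (hs : `|s| < 1).

(** Since [|a q^i| <= |a| < 1], no factor vanishes. With [a = q] and [a = s ^+ 2] this makes the
    denominators of the vertex weights nonzero. *)
Lemma qpoch_neq0 (a : C) (m : nat) : `|a| < 1 -> qpoch q a m != 0.
Proof.
move=> a1; apply/prodf_neq0 => i _; rewrite subr_eq0 eq_sym.
have aqi_lt1 : `|a * q ^+ i| < 1.
  rewrite normrM normrX; apply: le_lt_trans a1.
  by rewrite ler_piMr // exprn_ile1 // ltW.
by apply: contraTneq aqi_lt1 => ->; rewrite normr1 ltxx.
Qed.

Lemma xpochNs (l : nat) : xpoch q s (- s) l = (l == 0%N)%:R.
Proof.
case: l => [|l]; first by rewrite /xpoch big_ord0.
by rewrite /xpoch big_ord_recl expr0 mulr1 addNr mul0r.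
Qed.

(** At [x = -s] the argument [-s x] becomes [s^2], so the numerator [(-s x; q)_i (q; q)_i] coincides
    with the denominator. *)
Lemma vweightNs_straight (i : nat) : vweight q s (- s) i 0 i 0 = 1.
Proof.
have s21 : `|s ^+ 2| < 1 by rewrite normrX exprn_ilt1.
rewrite /vweight eqxx leq0n subn0 xpochNs mulrNN -expr2 /=.
rewrite [qpoch q q 0]big_ord0 !mul1r [X in _ / X]mulrC divff //.
by rewrite mulf_neq0 ?qpoch_neq0.
Qed.

(** The left edge [j] stays free here; it is shown to be zero separately, as the right edge of the
    preceding column. *)
Lemma vweightNs_neq0 (i j k l : nat) :
  vweight q s (- s) i j k l != 0 -> l = 0%N /\ (i + j = k)%N.
Proof.
rewrite /vweight xpochNs; case: ifP => [/andP[/eqP ijkl _]|]; last by rewrite eqxx.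
by case: l ijkl => [|l]; rewrite ?addn0 // !mul0r eqxx.
Qed.

Variable n : nat.
Implicit Types (hv : config n) (r : 'I_n).

Definition straight_row hv r : Prop :=
  hv.1 r = (fun=> 0%N) /\ hv.2 (lift ord0 r) = hv.2 (widen_ord (leqnSn n) r).

Lemma row_weightNs_straight hv r :
  straight_row hv r -> row_weight q s hv (- s) r = 1.
Proof.
move=> [h0 v0]; rewrite /row_weight h0 v0 xpochNs [qpoch q q 0]big_ord0 divr1 mul1r.
apply: lim_near_cst; first exact: norm_hausdorff.
by apply: nearW => N; rewrite big1 // => c _; apply: vweightNs_straight.
Qed.

Lemma row_weightNs_neq0 hv r :
  row_weight q s hv (- s) r != 0 -> straight_row hv r.
Proof.
pose w c := vweight q s (- s) (hv.2 (widen_ord (leqnSn n) r) c) (hv.1 r c)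
                              (hv.2 (lift ord0 r) c) (hv.1 r c.+1).
rewrite /row_weight xpochNs !mulf_eq0 !negb_or => /andP[/andP[h00 _] lim_neq0].
(* The edge leaving column 0 is controlled by the prefactor of the row, not by a vertex weight. *)
have {}h00 : hv.1 r 0%N = 0%N.
  by apply/eqP; move: h00; rewrite pnatr_eq0 eqb0 negbK.
(* A zero weight in column [c] would annihilate every partial product with [N > c], and hence the
   limit. *)
have w_neq0 c : w c != 0.
  apply: contraNneq lim_neq0 => wc0; apply/eqP/lim_near_cst.
    exact: norm_hausdorff.
  near=> N; have cN : (c < N)%N by near: N; exact: nbhs_infty_gt.
  by apply/eqP; rewrite prodf_seq_eq0; apply/hasP; exists c;
    rewrite ?mem_index_iota ?cN //= -/(w c) wc0.
have h0 : hv.1 r = (fun=> 0%N).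
  by apply/funext => -[|c]; [|have [] := vweightNs_neq0 (w_neq0 c)].
split=> //; apply/funext => c; have [_] := vweightNs_neq0 (w_neq0 c).
by rewrite h0 addn0.
Unshelve. all: by end_near. Qed.

End LastRow.

Section Restriction.
Variable n : nat.

Definition drop_last_row (hv : config n.+1) : config n :=
  (fun r => hv.1 (widen_ord (leqnSn n) r),
   fun r => hv.2 (widen_ord (leqnSn n.+1) r)).

(** [unlift ord_max] is [None] exactly at the new last index. Repeating the former top level
    [hv.2 ord_max] there preserves the upper boundary condition. *)
Definition add_straight_row (hv : config n) : config n.+1 :=
  (fun r => if unlift ord_max r is Some r' then hv.1 r' else fun=> 0%N,
   fun r => if unlift ord_max r is Some r' then hv.2 r' else hv.2 ord_max).

(** Reconciles the [widen_ord] of [row_weight] with [lift ord_max], the embedding that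
    [unlift ord_max] inverts. *)
Lemma widen_ord_lift_max m (i : 'I_m) : widen_ord (leqnSn m) i = lift ord_max i.
Proof. by apply/val_inj; rewrite /= /bump leqNgt ltn_ord. Qed.

Lemma lift0_max m : lift ord0 ord_max = ord_max :> 'I_m.+2.
Proof. exact/val_inj. Qed.

Lemma add_straight_rowK : cancel add_straight_row drop_last_row.
Proof.
move=> [h v]; congr pair; apply/funext => r /=;
  by rewrite widen_ord_lift_max liftK.
Qed.

Lemma straight_add_straight_row (hv : config n) :
  straight_row (add_straight_row hv) ord_max.
Proof.
split; rewrite /= ?lift0_max ?unlift_none //.
by rewrite widen_ord_lift_max liftK.
Qed.

Lemma drop_last_rowK (hv : config n.+1) :
  straight_row hv ord_max -> add_straight_row (drop_last_row hv) = hv.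
Proof.
case: hv => h v [/= h0 v0]; congr pair; apply/funext => r /=.
  by case: unliftP => [r'|] ->; rewrite /= ?widen_ord_lift_max.
case: unliftP => [r'|] ->; rewrite /= ?widen_ord_lift_max //.
(* At the top vertical level, straightness identifies it with the level below, which is the top of
   the truncated configuration. *)
by rewrite -widen_ord_lift_max -v0 lift0_max.
Qed.

Lemma admissible_drop_last_row (la mu : seq nat) (hv : config n.+1) :
  straight_row hv ord_max ->
  admissible la mu hv -> admissible la mu (drop_last_row hv).
Proof.
move=> [_ v0] [h0 vmu vla]; split=> [r|c|c] /=; first exact: h0.
  by rewrite -vmu; congr (hv.2 _ c); apply/val_inj.
by rewrite -vla -[ord_max in RHS]lift0_max v0.
Qed.

Lemma admissible_add_straight_row (la mu : seq nat) (hv : config n) :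
  admissible la mu hv -> admissible la mu (add_straight_row hv).
Proof.
move=> [h0 vmu vla]; split=> [r|c|c] /=.
- by case: unliftP => [r' _|_]; [exact: h0|exact: nearW].
- have -> : ord0 = lift ord_max ord0 :> 'I_n.+2 by apply/val_inj.
  by rewrite liftK.
- by rewrite unlift_none.
Qed.

Lemma row_weight_drop_last_row (C : numFieldType) (q s x : C)
    (hv : config n.+1) (r : 'I_n) :
  row_weight q s (drop_last_row hv) x r =
  row_weight q s hv x (widen_ord (leqnSn n) r).
Proof.
rewrite /row_weight /=.
by have -> : widen_ord (leqnSn n.+1) (lift ord0 r) =
             lift ord0 (widen_ord (leqnSn n) r) by apply/val_inj.
Qed.

End Restriction.

Lemma tnth_rcons_widen (T : Type) (n : nat) (x : n.-tuple T) (y : T) (r : 'I_n) :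
  tnth (rcons_tuple x y) (widen_ord (leqnSn n) r) = tnth x r.
Proof. by rewrite !(tnth_nth y) /= nth_rcons size_tuple ltn_ord. Qed.

Lemma tnth_rcons_max (T : Type) (n : nat) (x : n.-tuple T) (y : T) :
  tnth (rcons_tuple x y) ord_max = y.
Proof. by rewrite (tnth_nth y) /= nth_rcons size_tuple ltnn eqxx. Qed.

Lemma skew_spin_qW_rconsNs (C : numFieldType) (q s : C) (la mu : seq nat)
    (n : nat) (x : n.-tuple C) : `|q| < 1 -> `|s| < 1 ->
  skew_spin_qW q s la mu (rcons_tuple x (- s)) = skew_spin_qW q s la mu x.
Proof.
move=> hq hs; rewrite /skew_spin_qW.
pose P := [set hv : config n.+1 | admissible la mu hv /\ straight_row hv ord_max]%classic.
(* The summand vanishes off [P], so the support is unchanged and the default value 0 for infinite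
   supports applies alike to both sums. *)
rewrite -(@fsbig_widen _ _ _ _ P); first last.
- move=> hv [/= adm NP]; rewrite big_ord_recr /= tnth_rcons_max.
  apply/eqP; rewrite mulf_eq0; apply/orP; right.
  by apply: contra_notT NP => /row_weightNs_neq0 straight.
- by move=> hv [].
rewrite [RHS](@reindex_fsbig _ _ _ _ _ (@drop_last_row n) P); last first.
  split.
  - by move=> hv [adm straight]; apply: admissible_drop_last_row.
  (* Injectivity on [P]: a straight last row is determined by the rows below it. *)
  - move=> hv hv'; rewrite !inE => -[_ /drop_last_rowK K] [_ /drop_last_rowK K'] E.
    by rewrite -K E K'.
  - move=> hv adm; exists (add_straight_row hv); last exact: add_straight_rowK.
    by split; [exact: admissible_add_straight_row|exact: straight_add_straight_row].
apply: eq_fsbigr => hv; rewrite inE => -[_ straight].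
rewrite big_ord_recr /= tnth_rcons_max row_weightNs_straight // mulr1.
by apply: eq_bigr => r _; rewrite tnth_rcons_widen row_weight_drop_last_row.
Qed.

Theorem corollary6p4 (R : realType) (q s : R[i])
    (hq : `|q| < 1) (hs : `|s| < 1)
    (la mu : seq nat) (hla : is_partition la) (hmu : is_partition mu)
    (m : nat) (hm : (1 <= m)%N) (x : (m.-1).-tuple R[i]) :
  skew_spin_qW q s la mu (rcons_tuple x (- s)) =
  skew_spin_qW q s la mu x.
Proof. exact: skew_spin_qW_rconsNs. Qed.
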